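(* Let $G_1$ and $G_2$ be two connected graphs, each with $n$ vertices and $m$ edges, having Laplacian spectra $0=\mu_n<\mu_{n-1}\leq\cdots\leq\mu_1$ and $0=\lambda_n<\lambda_{n-1}\leq\cdots\leq\lambda_1$, respectively. Let $p\geq n+4$ be a positive integer such that $$\frac{2m}{p+n}<\min(\mu_{n-1},\lambda_{n-1}).$$ Then $LE(\overline{G_1}\cup K_p)=LE(\overline{G_2}\cup K_p)$.
   Context: All graphs are finite, undirected and simple. For a graph $G$ with $N$ vertices and $M$ edges, adjacency matrix $A(G)$ and diagonal degree matrix $D(G)$, the Laplacian matrix is $L(G)=D(G)-A(G)$; its eigenvalues with multiplicity, $\mu_1,\dots,\mu_N$, form the Laplacian spectrum of $G$. The Laplacian energy is $LE(G)=\sum_{i=1}^{N}\left|\mu_i-\frac{2M}{N}\right|$. $\overline{G}$ is the complement of $G$, $K_p$ the complete graph on $p$ vertices, and $G\cup H$ the disjoint union. Writing $\mu_{n-1}$ presupposes $n\ge 2$. *)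

(* Defs.v *)
From HB Require Import structures.
From mathcomp Require Import all_boot all_order all_algebra.
From mathcomp Require Import polyrcf complex.

Set Implicit Arguments.
Unset Strict Implicit.
Unset Printing Implicit Defensive.

Import Order.TTheory GRing.Theory Num.Theory.

Record sgraph := SGraph {
  vertex :> finType;
  adj : rel vertex;
  adj_sym : symmetric adj;
  adj_irrefl : irreflexive adj }.

Definition edges (G : sgraph) : {set {set G}} :=
  [set [set e.1; e.2] | e in [set e : G * G | adj e.1 e.2]].

Definition n_edges (G : sgraph) : nat := #|edges G|.

Definition degree (G : sgraph) (x : G) : nat := #|[set y | adj x y]|.

(* The graph without vertices satisfies this vacuously. *)
Definition connected (G : sgraph) : bool :=
  [forall x : G, forall y : G, connect (@adj G) x y].

Section Complement.
Variable G : sgraph.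
Definition compl_adj : rel G := fun x y => (x != y) && ~~ adj x y.
Lemma compl_adj_sym : symmetric compl_adj.
Proof. by move=> x y; rewrite /compl_adj eq_sym adj_sym. Qed.
Lemma compl_adj_irrefl : irreflexive compl_adj.
Proof. by move=> x; rewrite /compl_adj eqxx. Qed.
Definition compl_graph : sgraph := SGraph compl_adj_sym compl_adj_irrefl.
End Complement.

Section DisjointUnion.
Variables G H : sgraph.
Definition dunion_adj : rel (G + H)%type := fun u v =>
  match u, v with
  | inl x, inl y => adj x y
  | inr x, inr y => adj x y
  | _, _ => false
  end.
Lemma dunion_adj_sym : symmetric dunion_adj.
Proof. by move=> [x|x] [y|y] //=; rewrite adj_sym. Qed.
Lemma dunion_adj_irrefl : irreflexive dunion_adj.
Proof. by move=> [x|x] /=; rewrite adj_irrefl. Qed.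
Definition dunion_graph : sgraph := SGraph dunion_adj_sym dunion_adj_irrefl.
End DisjointUnion.

Section Complete.
Variable p : nat.
Definition complete_adj : rel 'I_p := fun x y => x != y.
Lemma complete_adj_sym : symmetric complete_adj.
Proof. by move=> x y; rewrite /complete_adj eq_sym. Qed.
Lemma complete_adj_irrefl : irreflexive complete_adj.
Proof. by move=> x; rewrite /complete_adj eqxx. Qed.
Definition complete_graph : sgraph :=
  SGraph complete_adj_sym complete_adj_irrefl.
End Complete.

Local Open Scope ring_scope.

Section Laplacian.
Variable R : rcfType.

Definition adjacency_mx (G : sgraph) : 'M[R]_#|G| :=
  \matrix_(i, j) (adj (enum_val i) (enum_val j))%:R.

Definition degree_mx (G : sgraph) : 'M[R]_#|G| :=
  diag_mx (\row_i (degree (enum_val i))%:R).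

Definition laplacian_mx (G : sgraph) : 'M[R]_#|G| :=
  degree_mx G - adjacency_mx G.

(* All the roots of the characteristic polynomial lie in R, the matrix being
   symmetric, so none is lost here: see laplacian_spectrumP. *)
Definition laplacian_spectrum (G : sgraph) : seq R :=
  let P := char_poly (laplacian_mx G) in
  sort >=%R (flatten [seq nseq (mup x P) x | x <- rootsR P]).

(* The k-th largest eigenvalue counted with multiplicity, for
   1 <= k <= #|G|. *)
Definition laplacian_eigenvalue (G : sgraph) (k : nat) : R :=
  (laplacian_spectrum G)`_k.-1.

Definition laplacian_energy (G : sgraph) : R :=
  \sum_(x <- laplacian_spectrum G) `|x - (2 * n_edges G)%:R / #|G|%:R|.

End Laplacian.

Lemma char_poly_symmetric (R : rcfType) n (A : 'M[R]_n) :
  A^T = A -> exists s : seq R, char_poly A = \prod_(x <- s) ('X - x%:P).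
Proof.
move=> A_sym; pose f := real_complex R; pose B := map_mx f A.
have B_herm : B \is hermsymmx.
  apply: realsym_hermsym.
    by apply/is_hermitianmxP; rewrite expr0 scale1r map_mx_id// /B map_trmx A_sym.
  apply/mxOverP => i j; rewrite mxE.
  by apply/complex_realP; exists (A i j).
have B_spec := orthomx_spectralP (hermitian_normalmx B_herm).
have d_real := mxOverP (hermitian_spectral_diag_real B_herm).
set P := spectralmx B in B_spec; set d := spectral_diag B in B_spec d_real.
have P_unit : P \in unitmx by exact: spectral_unit.
have cpB : char_poly B = char_poly (diag_mx d).
  rewrite {1}B_spec /char_poly /char_poly_mx !map_mxM /=.
  have PV : map_mx (@polyC _) (invmx P) *m map_mx (@polyC _) P = 1%:M.
    by rewrite -map_mxM mulVmx //= map_mx1.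
  rewrite -[X in X - _]mulmx1 -PV mul_scalar_mx scalemxAl -mul_mx_scalar -mulmxBl.
  rewrite -mulmxBr !det_mulmx mulrAC -det_mulmx PV det1 mul1r; congr (\det _).
exists [seq complex.Re (d 0 i) | i <- index_enum 'I_n].
apply: (map_poly_inj f); rewrite map_char_poly -/B cpB char_poly_trig ?diag_mx_is_trig //.
rewrite big_map rmorph_prod; apply: eq_bigr => i _.
by rewrite rmorphB /= map_polyX map_polyC /= mxE eqxx mulr1n /f RRe_real ?d_real.
Qed.

Lemma tr_laplacian_mx (R : rcfType) (G : sgraph) :
  (laplacian_mx R G)^T = laplacian_mx R G.
Proof.
apply/matrixP => i j; rewrite !mxE adj_sym eq_sym; case: eqP => [->|] //.
Qed.

Lemma laplacian_spectrumP (R : rcfType) (G : sgraph) :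
  char_poly (laplacian_mx R G) =
  \prod_(x <- laplacian_spectrum R G) ('X - x%:P).
Proof.
have [s Ps] := char_poly_symmetric (tr_laplacian_mx R G).
rewrite {1}Ps; apply: perm_big; rewrite /laplacian_spectrum perm_sym perm_sort.
apply/allP => x _ /=; apply/eqP; rewrite Ps.
have s_neq0 : \prod_(y <- s) ('X - y%:P) != 0 by rewrite monic_neq0 ?monic_prod_XsubC.
set rs := rootsR _.
have rs_uniq : uniq rs by apply: uniq_roots.
have rsE y : (y \in rs) = (y \in s).
  by rewrite /rs -(roots_on_rootsR s_neq0) in_itv root_prod_XsubC.
rewrite count_flatten -map_comp sumnE big_map.
under eq_bigr => y _ do rewrite /= count_nseq mu_prod_XsubC.
have [xs|xNs] := boolP (x \in s).
  rewrite (bigD1_seq x) ?rsE //= eqxx mul1n big1 ?addn0 // => y yx.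
  by rewrite (negPf yx).
rewrite (count_memPn xNs) big1_seq // => y /andP[_]; rewrite rsE => ys.
by rewrite /= (negPf (memPn xNs y ys)).
Qed.

Lemma laplacian_spectrum_sorted (R : rcfType) (G : sgraph) :
  sorted (fun x y : R => y <= x) (laplacian_spectrum R G).
Proof. by apply: sort_sorted => x y; apply: le_total. Qed.

Lemma size_laplacian_spectrum (R : rcfType) (G : sgraph) :
  size (laplacian_spectrum R G) = #|G|.
Proof.
have := size_char_poly (laplacian_mx R G).
by rewrite laplacian_spectrumP size_prod_XsubC => -[].
Qed.

(* Main.v *)
(* The Laplacian of the complement of G is n I - J - L(G), and the all-ones
   vector is an eigenvector of L(G); so if L(G) has eigenvalues 0 and the
   members x of t, the complement has eigenvalues 0 and the n - x.  Adding K_p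
   contributes 0 and p - 1 copies of p.  The mean degree d of the union exceeds
   every n - x, by the gap hypothesis together with p >= n + 4.  Hence the
   absolute values over the n - x open with a constant sign, and their sum
   involves the spectrum of G only through its trace 2m: the energy is an
   explicit function of n, m and p. *)

Require Import Defs.
From mathcomp Require Import all_boot all_order all_algebra perm ring lra.

Set Implicit Arguments.
Unset Strict Implicit.
Unset Printing Implicit Defensive.

Import Order.TTheory GRing.Theory Num.Theory.
Local Open Scope ring_scope.

(** Double counting of ordered adjacent pairs: grouped by first entry they give the degrees, and
    grouped by underlying edge they come in twos, since [adj] is symmetric and irreflexive. *)
Lemma sum_degree (G : sgraph) : (\sum_(x : G) degree x = 2 * n_edges G)%N.
Proof.
pose ends (e : G * G) := [set e.1; e.2].
transitivity (\sum_(e : G * G | adj e.1 e.2) 1)%N.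
  rewrite -(pair_big_dep xpredT (fun x y : G => adj x y) (fun _ _ => 1%N)) /=.
  by apply: eq_bigr => x _; rewrite sum1dep_card.
rewrite (partition_big ends (mem (edges G))) /=; last first.
  by move=> e e_adj; apply: imset_f; rewrite inE.
rewrite mulnC -sum_nat_const; apply: eq_bigr => E /imsetP[[a b]].
rewrite inE /= => ab_adj ->{E}.
have ab_neq : a != b by apply: contraTneq ab_adj => ->; rewrite adj_irrefl.
have ba_adj : adj b a by rewrite adj_sym.
rewrite (eq_bigl (mem [set (a, b); (b, a)])); first last.
  move=> [x y] /=; rewrite !inE !xpair_eqE /ends /=; apply/andP/orP.
    case=> xy_adj /eqP/setP xy_ab.
    have xy_neq : x != y by apply: contraTneq xy_adj => ->; rewrite adj_irrefl.
    have := xy_ab x; have := xy_ab y; rewrite !inE !eqxx orbT /=.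
    case/esym/orP=> /eqP yE /esym/orP[]/eqP xE; subst; rewrite ?eqxx in xy_neq *;
      by [| left | right].
  by case=> /andP[/eqP-> /eqP->]; split=> //; rewrite setUC.
by rewrite sum1_card cards2 xpair_eqE negb_and ab_neq.
Qed.

(** * Rank-one perturbation and the spectrum of a complement *)

(* If u spans an eigenline of M, both sides are the determinant of
   [[1, v], [-u, M]] * [[y, 0], [u, 1]] = [[y + v u, v], [0, M]]. *)
Lemma det_add_rank1 (R : comPzRingType) n (y : R) (M : 'M[R]_n)
    (u : 'cV[R]_n) (v : 'rV[R]_n) :
  M *m u = y *: u -> y * \det (M + u *m v) = (y + (v *m u) 0 0) * \det M.
Proof.
move=> Mu; pose B := block_mx 1%:M v (- u) M.
have detB : \det B = \det (M + u *m v).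
  have: block_mx 1%:M 0 u 1%:M *m B = block_mx 1%:M v 0 (M + u *m v).
    by rewrite mulmx_block !mul1mx !mul0mx !mulmx1 !addr0 subrr addrC.
  move/(congr1 determinant); rewrite det_mulmx det_lblock det_ublock !det1.
  by rewrite !mul1r.
have: B *m block_mx y%:M 0 u 1%:M = block_mx (y%:M + v *m u) v 0 M.
  rewrite mulmx_block !mul1mx !mulmx0 !mulmx1 !add0r mulNmx Mu.
  by rewrite mul_mx_scalar addNr.
move/(congr1 determinant).
rewrite det_mulmx det_lblock det_ublock det1 det_scalar1 mulr1 detB mulrC => ->.
by rewrite det_mx11 !mxE eqxx mulr1n.
Qed.

(** With J the all-ones matrix, the characteristic matrix of nI - J - L is M + J for M = (X - n)I +
    L, and the all-ones vector is an eigenvector of M for [y] = X - n. Hence [det_add_rank1] trades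
    one factor X - n of det M, coming from the root 0 of L, for y + n = X. *)
Lemma char_poly_compl (R : idomainType) n (L : 'M[R]_n) (t : seq R) :
  L *m const_mx 1 = 0 :> 'cV_n ->
  char_poly L = \prod_(x <- 0 :: t) ('X - x%:P) ->
  char_poly (n%:R%:M - const_mx 1 - L) =
    \prod_(x <- 0 :: [seq n%:R - x | x <- t]) ('X - x%:P).
Proof.
move=> L1 chL; pose y : {poly R} := 'X - n%:R%:P.
have y_neq0 : y != 0 by rewrite polyXsubC_eq0.
pose M : 'M[{poly R}]_n := y%:M + map_mx polyC L.
have M1 : M *m const_mx 1 = y *: const_mx 1 :> 'cV_n.
  rewrite mulmxDl mul_scalar_mx -[X in _ + _ *m X](map_const_mx polyC) ?polyC1.
  by rewrite -map_mxM L1 map_mx0 addr0.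
have detM : \det M = \prod_(x <- 0 :: t) ('X - (n%:R - x)%:P).
  (* There are as many roots as dimensions, so the sign (-1)^n produced by negating the matrix
     splits into one sign per linear factor. *)
  have sz : n = size (0 :: t).
    by have := size_char_poly L; rewrite chL size_prod_XsubC => -[<-].
  (* M is minus the characteristic matrix of L with n - X substituted for X. *)
  have -> : M = - map_mx (comp_poly (- y)) (char_poly_mx L).
    apply/matrixP => i j; rewrite !mxE rmorphB /= rmorphMn /= comp_polyX comp_polyC.
    by rewrite mulNrn opprB opprK addrC.
  rewrite -scaleN1r detZ det_map_mx -/(char_poly L) chL {1}sz.
  elim: (0 :: t) => [|x s IH]; first by rewrite !big_nil rmorph1 mulr1.
  rewrite !big_cons rmorphM exprS mulrACA IH /= rmorphB /= comp_polyX comp_polyC.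
  congr (_ * _); rewrite mulN1r opprB opprK /y polyCB; ring.
have := det_add_rank1 (const_mx 1 : 'rV_n) M1.
have -> : M + (const_mx 1 : 'cV_n) *m (const_mx 1 : 'rV_n) =
    char_poly_mx (n%:R%:M - const_mx 1 - L).
  apply/matrixP => i j; rewrite !mxE big_ord1 !mxE mulr1 /y !polyCB polyCMn.
  by rewrite mulrnBl; ring.
have -> : y + ((const_mx 1 : 'rV_n) *m (const_mx 1 : 'cV_n)) 0 0 = 'X.
    rewrite !mxE (eq_bigr (fun=> 1)) => [|i _]; last by rewrite !mxE mulr1.
  by rewrite sumr_const card_ord /y polyC_natr subrK.
rewrite -/(char_poly _) detM !big_cons big_map !subr0 mulrCA.
exact: mulfI.
Qed.

(** Both sides are the trace of the Laplacian, read off the subleading coefficient of the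
    characteristic polynomial and off the diagonal of degrees. *)
Lemma sum_laplacian_spectrum (R : rcfType) (G : sgraph) :
  \sum_(x <- laplacian_spectrum R G) x = (2 * n_edges G)%:R.
Proof.
(* The empty graph is set apart: its characteristic polynomial is constant and has no subleading
   coefficient. *)
have [G0|G_gt0] := posnP #|G|.
  rewrite -sum_degree [in RHS]big1 => [|x _]; last by have := fintype0 x G0.
  have /size0nil-> := etrans (size_laplacian_spectrum R G) G0.
  by rewrite big_nil.
have szS := size_laplacian_spectrum R G.
have := char_poly_trace (laplacian_mx R G) G_gt0.
rewrite laplacian_spectrumP -{1}szS coefPn_prod_XsubC ?szS -?lt0n // => /oppr_inj ->.
rewrite -sum_degree natr_sum /mxtrace.
rewrite (reindex _ (onW_bij _ (@enum_val_bij G))) /=.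
apply: eq_bigr => i _.
by rewrite !mxE eqxx mulr1n adj_irrefl subr0.
Qed.

Lemma laplacian_mx_row_sum (R : rcfType) (G : sgraph) :
  laplacian_mx R G *m const_mx 1 = 0 :> 'cV_#|G|.
Proof.
apply/matrixP => i j; rewrite mulmxBl mxE mul_diag_mx !mxE mulr1.
apply/eqP; rewrite subr_eq0 /degree -sum1dep_card natr_sum; apply/eqP.
rewrite (reindex _ (onW_bij _ (@enum_val_bij G))) big_mkcond /=.
by apply: eq_bigr => k _; rewrite !mxE mulr1; case: adj.
Qed.

(** * Laplacian matrices of complements and complete graphs *)

Lemma degree_compl (G : sgraph) (x : G) :
  (@degree (compl_graph G) x + degree x).+1 = #|G|.
Proof.
rewrite -[#|G|]cardsT (cardsD1 x) inE add1n; congr _.+1.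
rewrite -(cardsID [set y | ~~ adj x y] ([set: G] :\ x)).
congr (_ + _)%N; apply: eq_card => y; rewrite !inE /= ?andbT.
  by rewrite /compl_adj eq_sym.
rewrite negbK; case: eqP => [->|]; rewrite ?andbT ?andbF //=.
by rewrite adj_irrefl.
Qed.

Lemma laplacian_mx_compl (R : rcfType) (G : sgraph) :
  laplacian_mx R (compl_graph G) = #|G|%:R%:M - const_mx 1 - laplacian_mx R G.
Proof.
apply/matrixP => i j; rewrite !mxE.
have -> : #|G|%:R = (@degree (compl_graph G) (enum_val i))%:R +
    (@degree G (enum_val i))%:R + 1 :> R.
  by rewrite -natrD natr1 degree_compl.
move: (@degree (compl_graph G) _)%:R (@degree G _)%:R => d' d.
rewrite /= /compl_adj (inj_eq enum_val_inj).
case: eqP => [->|_] /=; first by rewrite adj_irrefl !mulr1n !subr0 !addrK.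
by case: adj; rewrite /= !mulr0n ?sub0r ?subr0 ?oppr0 ?opprK ?addNr ?addr0.
Qed.

Lemma laplacian_mx_complete (R : rcfType) p (K := complete_graph p) :
  laplacian_mx R K = #|K|%:R%:M - const_mx 1.
Proof.
apply/matrixP => i j; rewrite !mxE.
have -> : degree (enum_val i) = #|K|.-1.
  rewrite -[#|K|]cardsT (cardsD1 (enum_val i)) inE /=.
  by apply: eq_card => y; rewrite !inE andbT eq_sym.
have -> : #|K|%:R = #|K|.-1%:R + 1 :> R.
  by rewrite natr1 prednK //; apply: leq_ltn_trans (ltn_ord i).
rewrite /= /complete_adj (inj_eq enum_val_inj).
by case: eqP => _ /=; rewrite ?mulr1n ?mulr0n ?sub0r ?subr0 ?addrK.
Qed.

(** * Characteristic polynomials of disjoint unions and complete graphs *)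

(** Allows the vertices of a disjoint union to be listed in block order. Rows and columns undergo
    the same permutation, so the two signs cancel. *)
Lemma char_poly_mxsub_bij (R : comNzRingType) m n (f : 'I_m -> 'I_n)
    (A : 'M[R]_n) :
  bijective f -> char_poly (mxsub f f A) = char_poly A.
Proof.
move=> f_bij; have mn : m = n by have := bij_eq_card f_bij; rewrite !card_ord.
case: n / mn in f f_bij A *.
pose s := perm (bij_inj f_bij).
rewrite /char_poly.
have -> : char_poly_mx (mxsub f f A) = row_perm s (col_perm s (char_poly_mx A)).
  by apply/matrixP => i j; rewrite !mxE !permE (inj_eq (bij_inj f_bij)).
rewrite row_permE col_permE !det_mulmx !det_perm odd_permV.
by rewrite mulrCA -expr2 sqrr_sign mulr1.
Qed.

Lemma char_poly_block_diag (R : comNzRingType) m n (A : 'M[R]_m) (B : 'M[R]_n) :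
  char_poly (block_mx A 0 0 B) = char_poly A * char_poly B.
Proof.
by rewrite /char_poly char_block_diag_mx det_ublock.
Qed.

(** [inj] lists the vertices of G and then those of H; in that order the Laplacian of the union is
    block diagonal. *)
Lemma char_poly_laplacian_dunion (R : rcfType) (G H : sgraph) :
  char_poly (laplacian_mx R (dunion_graph G H)) =
  char_poly (laplacian_mx R G) * char_poly (laplacian_mx R H).
Proof.
pose inj (i : 'I_(#|G| + #|H|)) : dunion_graph G H :=
  match split i with inl a => inl (enum_val a) | inr b => inr (enum_val b) end.
pose inv (v : dunion_graph G H) : 'I_(#|G| + #|H|) :=
  match v with inl x => lshift _ (enum_rank x) | inr y => rshift _ (enum_rank y) end.
have injl a : inj (lshift _ a) = inl (enum_val a).
  by rewrite /inj (unsplitK (inl a)).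
have injr a : inj (rshift _ a) = inr (enum_val a).
  by rewrite /inj (unsplitK (inr a)).
have f_bij : bijective (enum_rank \o inj).
  apply: bij_comp; first exact: enum_rank_bij.
  exists inv => [i|[x|y]] /=; rewrite ?injl ?injr ?enum_rankK //.
  by case: (split_ordP i) => a ->; rewrite ?injl ?injr /= enum_valK.
have degl (x : G) : degree (inl x : dunion_graph G H) = degree x.
  rewrite /degree -[RHS](card_imset _ (inl_inj : injective (@inl G H))).
  apply: eq_card => -[y|y]; rewrite !inE.
    by rewrite mem_imset ?inE //; apply: inl_inj.
  by apply/esym/imsetP => -[].
have degr (x : H) : degree (inr x : dunion_graph G H) = degree x.
  rewrite /degree -[RHS](card_imset _ (inr_inj : injective (@inr G H))).
  apply: eq_card => -[y|y]; rewrite !inE.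
    by apply/esym/imsetP => -[].
  by rewrite mem_imset ?inE //; apply: inr_inj.
rewrite -char_poly_block_diag -(char_poly_mxsub_bij _ f_bij); congr char_poly.
apply/matrixP => i j.
case: (split_ordP i) => a ->; case: (split_ordP j) => b ->;
  rewrite ?block_mxEul ?block_mxEur ?block_mxEdl ?block_mxEdr !mxE;
  rewrite (inj_eq (bij_inj f_bij)) /= !enum_rankK ?injl ?injr ?degl ?degr;
  by rewrite ?eq_lshift ?eq_rshift ?eq_lrshift ?eq_rlshift ?subr0.
Qed.

(** K_p is the complement of the edgeless graph, so [char_poly_compl] applies to the zero matrix,
    whose roots are p zeros. *)
Lemma char_poly_laplacian_complete (R : rcfType) p :
  (0 < p)%N ->
  char_poly (laplacian_mx R (complete_graph p)) =
    \prod_(x <- 0 :: nseq p.-1 p%:R) ('X - x%:P).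
Proof.
move=> p_gt0; have cardK : #|complete_graph p| = p by rewrite /= card_ord.
have := @char_poly_compl R #|complete_graph p| 0 (nseq p.-1 0).
rewrite laplacian_mx_complete subr0 map_nseq subr0 cardK; apply.
  by rewrite mul0mx.
rewrite char_poly_trig ?mx0_is_trig // -[0 :: _]/(nseq p.-1.+1 0) prednK //.
rewrite big_nseq iter_mulr_1.
rewrite (eq_bigr (fun=> 'X - 0%:P)) => [|i _]; last by rewrite mxE.
by rewrite prodr_const card_ord.
Qed.

(** * The simple eigenvalue 0 and the energy formula *)

(** The all-ones vector puts 0 in the spectrum, and every entry before the last exceeds c >= 0, so 0
    can only be the last entry. *)
Lemma laplacian_spectrum_tail (R : rcfType) (G : sgraph) (c : R) :
  (1 < #|G|)%N -> 0 <= c -> c < laplacian_eigenvalue R G #|G|.-1 ->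
  exists2 t : seq R, laplacian_spectrum R G = rcons t 0
    & forall x, x \in t -> c < x.
Proof.
move=> n_gt1 c_ge0; rewrite /laplacian_eigenvalue.
have szS := size_laplacian_spectrum R G.
have S0 : 0 \in laplacian_spectrum R G.
  rewrite -root_prod_XsubC -laplacian_spectrumP -eigenvalue_root_char.
  apply/eigenvalueP; exists (const_mx 1); last first.
    apply/eqP=> /matrixP/(_ 0 (Ordinal (ltnW n_gt1)))/eqP.
    by rewrite !mxE oner_eq0.
  (* [eigenvalueP] asks for a row eigenvector; the symmetry of the Laplacian turns the column
     identity into one. *)
  apply: trmx_inj; rewrite scale0r trmx_mul tr_laplacian_mx trmx_const trmx0.
  exact: laplacian_mx_row_sum.
have := laplacian_spectrum_sorted R G.
case/lastP: (laplacian_spectrum R G) szS S0 => [<- //|t z].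
rewrite size_rcons => szS S0 S_sorted c_lt.
(* The eigenvalue of rank [#|G|.-1] sits at index [#|G|.-2], the last position of [t], so it is the
   least member of [t] in the decreasing order. *)
have t_gt x : x \in t -> c < x.
  case/(nthP 0) => i i_lt <-; apply: lt_le_trans c_lt _.
  have t_gt0 : (0 < size t)%N by apply: leq_ltn_trans i_lt.
  rewrite -szS /= nth_rcons prednK // leqnn.
  have ge_trans : transitive (fun x y : R => y <= x).
    by move=> y x' z' yx xz; apply: le_trans yx.
  have := sorted_leq_nth ge_trans _ 0 (subseq_sorted ge_trans (subseq_rcons t z) S_sorted).
  by apply; rewrite ?inE ?prednK // -ltnS prednK.
exists t => //; move: S0; rewrite mem_rcons inE => /predU1P[<- //|/t_gt].
by rewrite ltNge c_ge0.
Qed.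

(** [d] is the mean degree of the union: its numerator adds the degree sums of the complement and of
    K_p. The three summands of the energy come from the two zero eigenvalues, the n - 1 values n -
    x, and the p - 1 copies of p. *)
Lemma laplacian_energy_compl_complete (R : rcfType) (G : sgraph) (n m p : nat)
    (N := (p + n)%:R : R)
    (d := (n%:R * (n%:R - 1) - (2 * m)%:R + p%:R * (p%:R - 1)) / N) :
  (1 < n)%N -> #|G| = n -> n_edges G = m -> (n + 4 <= p)%N ->
  (2 * m)%:R / N < laplacian_eigenvalue R G n.-1 ->
  laplacian_energy R (dunion_graph (compl_graph G) (complete_graph p)) =
  `|d| *+ 2 + ((d - n%:R) * (n%:R - 1) + (2 * m)%:R) + `|p%:R - d| *+ p.-1.
Proof.
move=> n_gt1 Gn Gm p_ge gap.
have p_gt0 : (0 < p)%N by apply: leq_trans p_ge; rewrite addn4.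
have N_gt0 : 0 < N by rewrite ltr0n addn_gt0 p_gt0.
have [t specG t_gt] : exists2 t : seq R, laplacian_spectrum R G = rcons t 0
    & forall x, x \in t -> (2 * m)%:R / N < x.
  by apply: laplacian_spectrum_tail; rewrite ?Gn // divr_ge0 // ltW.
have sz_t : size t = n.-1.
  have := size_laplacian_spectrum R G.
  by rewrite specG size_rcons Gn => <-.
have sum_t : \sum_(x <- t) x = (2 * m)%:R.
  by rewrite -Gm -sum_laplacian_spectrum specG big_rcons /= addr0.
have mulrn_pred k (y : R) : (0 < k)%N -> y *+ k.-1 = y * (k%:R - 1).
  by move=> k_gt0; rewrite -subn1 mulrnBr // mulrBr mulr_natr mulr1.
have n_gt0 := ltnW n_gt1.
set H := dunion_graph _ _.
(* A product of monic linear factors determines its roots up to order, so comparing characteristic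
   polynomials suffices. *)
have specH : perm_eq (laplacian_spectrum R H)
    ((0 :: [seq n%:R - x | x <- t]) ++ 0 :: nseq p.-1 p%:R).
  apply: prod_XsubC_eq; rewrite -laplacian_spectrumP char_poly_laplacian_dunion.
  rewrite big_cat char_poly_laplacian_complete // laplacian_mx_compl; congr (_ * _).
  rewrite -Gn; apply: (char_poly_compl (laplacian_mx_row_sum R G)).
  rewrite laplacian_spectrumP; apply: perm_big.
  by rewrite specG perm_rcons.
have sum_compl_t : \sum_(x <- t) (n%:R - x) = n%:R * (n%:R - 1) - (2 * m)%:R.
  by rewrite big_split sumrN sum_t big_const_seq count_predT iter_addr_0 sz_t mulrn_pred.
(* Instead of counting the edges of the union, twice their number is obtained as the sum of its
   eigenvalues. *)
have avgH : (2 * n_edges H)%:R / #|H|%:R = d.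
  rewrite -sum_laplacian_spectrum (perm_big _ specH) big_cat !big_cons big_map /=.
  rewrite big_nseq iter_addr_0 !add0r sum_compl_t mulrn_pred //.
  by rewrite card_sum /= card_ord Gn addnC.
rewrite /laplacian_energy avgH (perm_big _ specH) big_cat !big_cons big_map /=.
rewrite big_nseq iter_addr_0 !sub0r normrN.
have d_ge x : x \in t -> n%:R - x - d <= 0.
  (* (n - d) * N = (n + p) + 2m - p (p - n), and p >= n + 4 makes the product
     p (p - n) larger than n + p. *)
  move/t_gt; rewrite ltr_pdivrMr // => xN.
  have pE : 4 <= p%:R - n%:R :> R by rewrite lerBrDl -natrD ler_nat.
  have n_ge0 : 0 <= n%:R :> R by [].
  rewrite -(pmulr_lle0 _ N_gt0) !mulrBl divfK ?gt_eqF // mulrC.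
  move: xN; rewrite /N natrD; nra.
have -> : \sum_(x <- t) `|n%:R - x - d| = (d - n%:R) * (n%:R - 1) + (2 * m)%:R.
  rewrite big_seq (eq_bigr (fun x => d - (n%:R - x))) => [|x xt]; last first.
    by rewrite ler0_norm ?d_ge // opprB.
  rewrite -big_seq big_split sumrN sum_compl_t /=.
  rewrite big_const_seq count_predT iter_addr_0 sz_t mulrn_pred //; ring.
ring.
Qed.

Theorem theorem3p8 (R : rcfType) (G1 G2 : sgraph) (n m p : nat)
    (n_ge2 : (2 <= n)%N)
    (G1_conn : connected G1) (G2_conn : connected G2)
    (G1_order : #|G1| = n) (G2_order : #|G2| = n)
    (G1_size : n_edges G1 = m) (G2_size : n_edges G2 = m)
    (p_ge : (n + 4 <= p)%N)
    (gap : (2 * m)%:R / (p + n)%:R <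
           Num.min (laplacian_eigenvalue R G1 n.-1)
                   (laplacian_eigenvalue R G2 n.-1)) :
  laplacian_energy R (dunion_graph (compl_graph G1) (complete_graph p)) =
  laplacian_energy R (dunion_graph (compl_graph G2) (complete_graph p)).
Proof.
move: gap; rewrite lt_min => /andP[gap1 gap2].
rewrite (laplacian_energy_compl_complete n_ge2 G1_order G1_size p_ge gap1).
by rewrite (laplacian_energy_compl_complete n_ge2 G2_order G2_size p_ge gap2).
Qed.
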